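(* In the setting described in the context, let $h_w(z)=h_w z$ and $h_v(z)=h_v z$ be linear with non-negative constants $h_w,h_v$, and let $D_t^{CE}(\mathbf{x})=\bar V_t(\mathbf{x})-J_t^{CE}(\mathbf{x})$. Then for all $t=0,1,\dots,T$ and all $\mathbf{x}\in\mathbb{N}^m$ with $\|\mathbf{x}\|_1\le x_{max}$, $$D_t^{CE}(\mathbf{x})\le\max_{\|\mathbf{y}\|_1\le x_{max}}\left\{\frac{h_w}{2}\left(\sqrt{\sigma_W^2(\mathbf{y})+(C_w-\bar w(\mathbf{y}))^2}-|C_w-\bar w(\mathbf{y})|\right)+\frac{h_v}{2}\left(\sqrt{\sigma_V^2(\mathbf{y})+(C_v-\bar v(\mathbf{y}))^2}-|C_v-\bar v(\mathbf{y})|\right)\right\},$$ where the maximum is over $\mathbf{y}\in\mathbb{N}^m$, and $\bar w(\mathbf{y}),\sigma_W^2(\mathbf{y})$ and $\bar v(\mathbf{y}),\sigma_V^2(\mathbf{y})$ denote the mean and variance of $\sum_{i=1}^m\sum_{j=1}^{y_i}W_{ij}$ and of $\sum_{i=1}^m\sum_{j=1}^{y_i}U_{ij}$, respectively.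
   Context: There are $m$ booking types and periods $t=0,1,\dots,T-1$; departure is at $t=T$. A type $i$ booking has a non-negative random weight $W_i$ and volume $U_i$ with finite means and variances. In period $t$ at most one booking request arrives; it is of type $i$ with probability $m_t^i\ge0$, where $\sum_i m_t^i\le 1$. The reservation price for type $i$ in period $t$ has a differentiable cumulative distribution function $F_t^i$. Prices range over $(0,\infty)$. Put $b_t^i(r)=m_t^i(1-F_t^i(r))$ and $Q_i=E[\max\{W_i,U_i/\gamma\}]$, where $\gamma>0$ is a constant. The state $\mathbf{x}\in\mathbb{N}^m$ (non-negative integers) records the numbers of accepted bookings; $\mathbf{e}_i$ is the $i$-th unit vector; $\|\mathbf{x}\|_1=\sum_i x_i$; $z^+=\max\{z,0\}$; $C_w,C_v$ are the capacities. The $(W_{ij},U_{ij})$ are independent, with $(W_{ij},U_{ij})$ distributed as $(W_i,U_i)$. A maximum acceptable number of bookings $x_{max}$ is fixed: only states with $\|\mathbf{x}\|_1\le x_{max}$ are considered and no booking is accepted when $\|\mathbf{x}\|_1=x_{max}$. Certainty Equivalent (CE) model: for $\|\mathbf{x}\|_1<x_{max}$ and $t=0,\dots,T-1$, $$\bar V_t(\mathbf{x})=\sum_{i=1}^m\sup_{r_i}\left\{b_t^i(r_i)\left(r_iQ_i-(\bar V_{t+1}(\mathbf{x})-\bar V_{t+1}(\mathbf{x}+\mathbf{e}_i))\right)\right\}+\bar V_{t+1}(\mathbf{x}),$$ (and $\bar V_t(\mathbf{x})=\bar V_{t+1}(\mathbf{x})$ if $\|\mathbf{x}\|_1=x_{max}$),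 with $$\bar V_T(\mathbf{x})=-h_w\left(\left(\sum_{i=1}^m x_iE[W_i]-C_w\right)^+\right)-h_v\left(\left(\sum_{i=1}^m x_iE[U_i]-C_v\right)^+\right).$$ The CE price $\bar r_i=\bar r_i(t,\mathbf{x})$ is a maximizer of the $i$-th supremum (assumed to be attained). $J_t^{CE}(\mathbf{x})$ is the expected revenue-to-go of using the CE prices in the original model with random weights and volumes: for $\|\mathbf{x}\|_1<x_{max}$ and $t=0,\dots,T-1$, $$J_t^{CE}(\mathbf{x})=\sum_{i=1}^m b_t^i(\bar r_i)\left(\bar r_iQ_i-(J_{t+1}^{CE}(\mathbf{x})-J_{t+1}^{CE}(\mathbf{x}+\mathbf{e}_i))\right)+J_{t+1}^{CE}(\mathbf{x}),$$ (and $J_t^{CE}(\mathbf{x})=J_{t+1}^{CE}(\mathbf{x})$ if $\|\mathbf{x}\|_1=x_{max}$), with $$J_T^{CE}(\mathbf{x})=-E\left[h_w\left(\left(\sum_{i=1}^m\sum_{j=1}^{x_i}W_{ij}-C_w\right)^+\right)+h_v\left(\left(\sum_{i=1}^m\sum_{j=1}^{x_i}U_{ij}-C_v\right)^+\right)\right].$$ *)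

(* Defs.v *)
From HB Require Import structures.
From mathcomp Require Import all_boot all_order all_algebra.
From mathcomp Require Import all_classical all_reals all_analysis.

Set Implicit Arguments.
Unset Strict Implicit.
Unset Printing Implicit Defensive.

Import Order.TTheory GRing.Theory Num.Theory.
Import numFieldNormedType.Exports.

Local Open Scope classical_set_scope.
Local Open Scope ring_scope.

Section Probability.
Context {R : realType} {d : measure_display} {Omega : measurableType d}.
Variable P : probability Omega R.

(* Mutual independence of a possibly infinite family: the product rule over
   every finite subfamily. *)
Definition mutually_independent (I : eqType) (d' : measure_display)
    (S : measurableType d') (X : I -> Omega -> S) : Prop :=
  forall (s : seq I) (A : I -> set S), uniq s ->
    (forall k, k \in s -> measurable (A k)) ->
    P (\big[setI/setT]_(k <- s) (X k @^-1` A k)) =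
    (\prod_(k <- s) P (X k @^-1` A k))%E.

Definition same_distribution (d' : measure_display) (S : measurableType d')
    (X Y : Omega -> S) : Prop :=
  forall A : set S, measurable A -> P (X @^-1` A) = P (Y @^-1` A).

Definition rpair (X Y : {RV P >-> R}) (w : Omega) : R * R := (X w, Y w).

Definition mean (X : Omega -> R) : R := fine 'E_P[X].

Definition var (X : Omega -> R) : R := fine 'V_P[X].

End Probability.

Section States.
Variable m : nat.

Definition state := {ffun 'I_m -> nat}.

Definition norm1 (x : state) : nat := (\sum_(i < m) x i)%N.

Definition add_booking (x : state) (i : 'I_m) : state :=
  [ffun k => (x k + (k == i))%N].

Definition state0 : state := [ffun => 0%N].

(* The finitely many states of norm at most [xmax] have coordinates at most
   [xmax], so they are all images of the finite type below. *)
Definition state_of_bounded (xmax : nat) (y : {ffun 'I_m -> 'I_xmax.+1}) :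
  state := [ffun i => nat_of_ord (y i)].

(* The initial value [E state0] of the iterated maximum is itself one of the
   values over which the maximum is taken; see [max_statesP]. *)
Definition max_states {R : realType} (xmax : nat) (E : state -> R) : R :=
  \big[Num.max/E state0]_(y : {ffun 'I_m -> 'I_xmax.+1}
      | (norm1 (state_of_bounded y) <= xmax)%N) E (state_of_bounded y).

Lemma max_statesP {R : realType} (xmax : nat) (E : state -> R) :
  (exists2 y, (norm1 y <= xmax)%N & max_states xmax E = E y) /\
  (forall y, (norm1 y <= xmax)%N -> E y <= max_states xmax E).
Proof.
split.
  rewrite /max_states; elim/big_ind: _.
  - exists state0 => //; rewrite /norm1 big1// => i _; by rewrite ffunE.
  - move=> a b [y hy ->] [z hz ->].
    by case: (leP (E y) (E z)) => _; [exists z | exists y].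
  - by move=> y hy; exists (state_of_bounded y).
move=> y hy.
have hyi i : (y i < xmax.+1)%N.
  by rewrite ltnS (leq_trans _ hy)// /norm1 (bigD1 i)//= leq_addr.
have yE : y = state_of_bounded [ffun i => Ordinal (hyi i)].
  by apply/ffunP => i; rewrite !ffunE.
rewrite {1}yE /max_states.
apply: (le_bigmax_cond _ (fun y => E (state_of_bounded y))).
by rewrite -yE.
Qed.

End States.

Section Recursions.
Context {R : realType} {m : nat}.

(* [step t V] is the value function at time [t] when [V] is the one at time
   [t.+1]; the first argument of [backward] is the number of remaining
   periods. *)
Fixpoint backward_togo (step : nat -> (state m -> R) -> state m -> R)
    (VT : state m -> R) (T n : nat) : state m -> R :=
  if n is n'.+1 then step (T - n'.+1)%N (backward_togo step VT T n') else VT.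

Definition backward step VT T (t : nat) : state m -> R :=
  backward_togo step VT T (T - t)%N.

Lemma backward_end step VT T : backward step VT T T = VT.
Proof. by rewrite /backward subnn. Qed.

Lemma backwardS step VT T t : (t < T)%N ->
  backward step VT T t = step t (backward step VT T t.+1).
Proof.
by move=> tT; rewrite /backward -subnSK//= subnSK// subKn// ltnW.
Qed.

(* Probability of an accepted booking of type [i] in period [t] at price [r];
   [q t i] is the arrival probability and [F t i] the distribution function of
   the reservation price. *)
Definition booking_prob (q : nat -> 'I_m -> R) (F : nat -> 'I_m -> R -> R)
    (t : nat) (i : 'I_m) (r : R) : R := q t i * (1 - F t i r).

Variables (b : nat -> 'I_m -> R -> R) (Q : 'I_m -> R) (xmax : nat).

(* Expected gain from pricing type [i] at [r] when [V] is the next value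
   function. *)
Definition gain (V : state m -> R) (t : nat) (x : state m) (i : 'I_m) (r : R) :
  R := b t i r * (r * Q i - (V x - V (add_booking x i))).

(* [sup] is the real supremum, with junk value on unbounded sets; under
   [maximizing_price] below every supremum in play is attained. *)
Definition opt_step (t : nat) (V : state m -> R) (x : state m) : R :=
  if (norm1 x < xmax)%N then
    \sum_(i < m) sup [set gain V t x i r | r in `]0, +oo[] + V x
  else V x.

Definition price_step (rbar : nat -> state m -> 'I_m -> R)
    (t : nat) (V : state m -> R) (x : state m) : R :=
  if (norm1 x < xmax)%N then
    \sum_(i < m) gain V t x i (rbar t x i) + V x
  else V x.

(* [rbar t x i] attains the [i]-th supremum defining [backward opt_step] at
   every period and state where bookings may be accepted. *)
Definition maximizing_price (VT : state m -> R) (T : nat)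
    (rbar : nat -> state m -> 'I_m -> R) : Prop :=
  forall (t : nat) (x : state m) (i : 'I_m),
    (t < T)%N -> (norm1 x < xmax)%N ->
    0 < rbar t x i /\
    forall r : R, 0 < r ->
      gain (backward opt_step VT T t.+1) t x i r <=
      gain (backward opt_step VT T t.+1) t x i (rbar t x i).

End Recursions.

Section CargoModel.
Context {R : realType} {d : measure_display} {Omega : measurableType d}.
Variables (P : probability Omega R) (m : nat).

(* Bookings of type [i] are numbered from 0, so [X i j] is the weight (or
   volume) of the [j.+1]-th one. *)
Definition booking_sum (X : 'I_m -> nat -> {RV P >-> R}) (x : state m)
    (w : Omega) : R :=
  \sum_(i < m) \sum_(j < x i) X i j w.

Definition chargeable_weight (W U : 'I_m -> {RV P >-> R}) (gamma : R)
    (i : 'I_m) : R :=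
  mean P (fun w => Num.max (W i w) (U i w / gamma)).

Definition pos_part (z : R) : R := Num.max z 0.

Definition ce_terminal (W U : 'I_m -> {RV P >-> R}) (hw hv : R -> R)
    (Cw Cv : R) (x : state m) : R :=
  - hw (pos_part (\sum_(i < m) (x i)%:R * mean P (W i) - Cw))
  - hv (pos_part (\sum_(i < m) (x i)%:R * mean P (U i) - Cv)).

Definition random_terminal (Wb Ub : 'I_m -> nat -> {RV P >-> R})
    (hw hv : R -> R) (Cw Cv : R) (x : state m) : R :=
  - mean P (fun w => hw (pos_part (booking_sum Wb x w - Cw)) +
                     hv (pos_part (booking_sum Ub x w - Cv))).

Definition overload_bound (h C : R) (X : 'I_m -> nat -> {RV P >-> R})
    (y : state m) : R :=
  h / 2 * (Num.sqrt (var P (booking_sum X y) +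
                     (C - mean P (booking_sum X y)) ^+ 2)
           - `|C - mean P (booking_sum X y)|).

End CargoModel.

(* Main.v *)
(* Both recursions apply the same prices, so the gap V - J at time t is a convex
   combination of gaps at time t + 1 and is bounded by the largest terminal
   gap. For the latter, z^+ = (z + |z|) / 2 and, for the total S of the
   bookings, E|S - C| <= sqrt(E(S - C)^2) = sqrt(Var S + (C - ES)^2). *)
Require Import Defs.
From HB Require Import structures.
From mathcomp Require Import all_boot all_order all_algebra.
From mathcomp Require Import all_classical all_reals all_analysis.
From mathcomp Require Import measurable_realfun ring lra.
Import Order.TTheory GRing.Theory Num.Theory.
Import numFieldNormedType.Exports.
Local Open Scope classical_set_scope.
Local Open Scope ring_scope.

Set Implicit Arguments.
Unset Strict Implicit.
Unset Printing Implicit Defensive.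

(** * Square-integrable variables and the mean of a positive part *)

Section SecondMoment.
Context {R : realType} {d : measure_display} {Omega : measurableType d}.
Variable P : probability Omega R.
Implicit Types X Y : Omega -> R.

Lemma Lfun_measurable p X : X \in Lfun P p -> measurable_fun setT X.
Proof. by rewrite inE => /andP[/[!inE]]. Qed.

Lemma Lfun2_Lfun1 X : X \in Lfun P 2%:E -> X \in Lfun P 1.
Proof. by apply: Lfun_subset12; exact: fin_num_measure. Qed.

Lemma sqr_lty_Lfun2 X : measurable_fun setT X ->
  (\int[P]_w (X w ^+ 2)%:E < +oo)%E -> X \in Lfun P 2%:E.
Proof.
move=> mX X2; rewrite inE; apply/andP; split; rewrite inE//=.
rewrite /finite_norm unlock poweR_lty//.
under eq_integral do rewrite /= powR_mulrn// real_normK ?num_real//.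
exact: X2.
Qed.

(** The variance is the integral of [(X - c)^2], so finiteness puts [X - c] in L2, and constants are
    in L2 of a probability. *)
Lemma variance_lty_Lfun2 X : measurable_fun setT X ->
  ('V_P[X] < +oo)%E -> X \in Lfun P 2%:E.
Proof.
move=> mX; rewrite /variance unlock expectation.unlock => V.
(* Any real [c] would do here: it does not matter that [fine] would return 0 on an infinite mean. *)
set c := fine _ in V.
have -> : X = (X \- cst c) + cst c by apply/funext => w; rewrite !fctE subrK.
rewrite rpredD ?lee1n// => p1; last exact: Lfun_cst.
apply: sqr_lty_Lfun2; first exact: (measurable_funB mX (measurable_cst _)).
exact: V.
Qed.

Lemma meanD X Y : X \in Lfun P 1 -> Y \in Lfun P 1 ->
  mean P (X \+ Y) = mean P X + mean P Y.
Proof.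
by move=> *; rewrite /mean expectationD// fineD ?expectation_fin_num.
Qed.

Lemma meanZ X k : X \in Lfun P 1 -> mean P (k \o* X) = k * mean P X.
Proof.
by move=> *; rewrite /mean expectationZl// fineM ?expectation_fin_num.
Qed.

Lemma mean_cst c : mean P (cst c) = c.
Proof. by rewrite /mean expectation_cst. Qed.

Lemma Lfun_sum p (p1 : (1 <= p)%E) (I : Type) (s : seq I)
    (X : I -> Omega -> R) : (forall i, X i \in Lfun P p) ->
  (fun w => \sum_(i <- s) X i w) \in Lfun P p.
Proof.
move=> Xp; have -> : (fun w => \sum_(i <- s) X i w) = \sum_(i <- s) X i.
  by apply/funext => w; rewrite fct_sumE.
by rewrite rpred_sum.
Qed.

Lemma mean_sum (I : Type) (s : seq I) (X : I -> Omega -> R) :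
  (forall i, X i \in Lfun P 1) ->
  mean P (fun w => \sum_(i <- s) X i w) = \sum_(i <- s) mean P (X i).
Proof.
move=> X1; elim: s => [|i s IHs].
  rewrite big_nil -[RHS]mean_cst; congr mean.
  by apply/funext => w; rewrite big_nil.
rewrite big_cons -IHs -meanD ?Lfun_sum//; congr mean.
by apply/funext => w; rewrite big_cons.
Qed.

(** The variance of [|X|] is non-negative, so [(E|X|)^2 <= E[X^2] = Var X + (E X)^2]. *)
Lemma mean_normr_le X : X \in Lfun P 2%:E ->
  mean P (Num.norm \o X) <= Num.sqrt (var P X + mean P X ^+ 2).
Proof.
move=> X2; have X1 := Lfun2_Lfun1 X2.
have mX := Lfun_measurable X2.
have N2 : Num.norm \o X \in Lfun P 2%:E.
  apply: sqr_lty_Lfun2; first exact: measurableT_comp.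
  under eq_integral do rewrite /= real_normK ?num_real//.
  by apply: integrable_lty => //; exact: Lfun2_integrable_sqr.
have sqrE : (Num.norm \o X) ^+ 2 = X ^+ 2.
  by apply/funext => w; rewrite !fctE real_normK// num_real.
have E1 := fineK (expectation_fin_num X1).
have E2 : (fine 'E_P[X ^+ 2])%:E = 'E_P[X ^+ 2]%E.
  by rewrite fineK// expectation_fin_num// Lfun2_mul_Lfun1.
have EN := fineK (expectation_fin_num (Lfun2_Lfun1 N2)).
have varE : var P X + mean P X ^+ 2 = fine 'E_P[X ^+ 2].
  rewrite /var /mean varianceE// -E2 -E1 -EFin_expe -EFinB.
  exact: subrK.
(* As [E|X| >= 0], it is the root of its own square, and monotonicity of the root leaves a
   comparison of squares. *)
rewrite varE -[leLHS]ger0_norm; last first.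
  by rewrite fine_ge0// expectation_ge0// => w /=.
rewrite -sqrtr_sqr ler_wsqrtr// -lee_fin E2 /mean EFin_expe EN.
have := variance_ge0 P (Num.norm \o X).
rewrite varianceE// sqrE -E2 -EN -EFin_expe -EFinB !lee_fin.
by rewrite subr_ge0.
Qed.

Lemma pos_partE (z : R) : pos_part z = (z + `|z|) * 2^-1.
Proof. by rewrite /pos_part maxr_absE subr0 addr0. Qed.

(** Write both positive parts as [(z + |z|) / 2], with [z = X - C] and with its mean. The linear
    terms cancel, and what remains is half of [E|X - C| - |E X - C|]. *)
Lemma mean_pos_part_le X C : X \in Lfun P 2%:E ->
  ((fun w => pos_part (X w - C)) \in Lfun P 1) /\
  mean P (fun w => pos_part (X w - C)) <= pos_part (mean P X - C) +
    2^-1 * (Num.sqrt (var P X + (C - mean P X) ^+ 2) - `|C - mean P X|).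
Proof.
move=> X2; pose Y := X \+ cst (- C).
have Y2 : Y \in Lfun P 2%:E.
  by rewrite rpredD ?lee1n// => p1; exact: Lfun_cst.
have Y1 := Lfun2_Lfun1 Y2; have NY1 := Lfun_norm Y1.
have YNY1 : Y \+ (Num.norm \o Y) \in Lfun P 1 by rewrite rpredD.
have -> : (fun w => pos_part (X w - C)) = 2^-1 \o* (Y \+ (Num.norm \o Y)).
  by apply/funext => w; rewrite pos_partE.
split; first exact: Lfun_scale.
have mY : mean P Y = mean P X - C.
  by rewrite meanD ?mean_cst ?Lfun_cst// Lfun2_Lfun1.
have vY : var P Y = var P X by rewrite /var varianceD_cst_r.
rewrite meanZ// meanD// pos_partE mY distrC.
have := mean_normr_le Y2; rewrite mY vY -(sqrrN (mean P X - C)) opprB.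
lra.
Qed.

End SecondMoment.

(** * Transfer of moments between identically distributed variables *)

Section SameDistribution.
Context {R : realType} {d : measure_display} {Omega : measurableType d}.
Variable P : probability Omega R.
Implicit Types X Y : {RV P >-> R}.

Lemma same_distribution_fst X X' Y Y' :
  same_distribution P (rpair X X') (rpair Y Y') -> same_distribution P X Y.
Proof.
move=> XY A mA; have := XY (A `*` setT) (measurableX mA measurableT).
have preE (Z Z' : {RV P >-> R}) : rpair Z Z' @^-1` (A `*` setT) = Z @^-1` A.
  by apply/seteqP; split=> w //= [].
by rewrite !preE.
Qed.

(** Both sides are integrals of [f] against the laws of [X] and [Y], which agree on measurable
    sets. *)
Lemma same_distribution_ge0_integral X Y (f : R -> \bar R) :
  same_distribution P X Y -> measurable_fun [set: R] f ->
  (forall x, 0 <= f x)%E ->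
  (\int[P]_w f (X w) = \int[P]_w f (Y w))%E.
Proof.
move=> XY mf f0.
rewrite -(ge0_integral_distribution X mf f0).
rewrite -(ge0_integral_distribution Y mf f0).
by apply: eq_measure_integral => A mA _; exact: XY.
Qed.

Lemma same_distribution_Lfun2 X Y : same_distribution P X Y ->
  (Y : _ -> _) \in Lfun P 2%:E -> (X : _ -> _) \in Lfun P 2%:E.
Proof.
move=> XY Y2; apply: sqr_lty_Lfun2 => //.
rewrite (same_distribution_ge0_integral (f := fun x => (x ^+ 2)%:E) XY) //.
- by apply: integrable_lty => //; exact: Lfun2_integrable_sqr.
- by apply/measurable_EFinP.
- by move=> x; rewrite lee_fin sqr_ge0.
Qed.

(** The identity changes sign, so here the change of variables rests on integrability instead of
    non-negativity. *)
Lemma same_distribution_mean X Y : same_distribution P X Y ->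
  (X : _ -> _) \in Lfun P 1 -> (Y : _ -> _) \in Lfun P 1 ->
  mean P X = mean P Y.
Proof.
move=> XY /Lfun1_integrable X1 /Lfun1_integrable Y1.
have mE : measurable_fun [set: R] (@EFin R) by exact: measurable_funTS.
rewrite /mean !expectation_def; congr fine.
rewrite -(integral_distribution mE X1) -(integral_distribution mE Y1).
by apply: eq_measure_integral => A mA _; exact: XY.
Qed.

Lemma same_distribution_snd X X' Y Y' :
  same_distribution P (rpair X X') (rpair Y Y') -> same_distribution P X' Y'.
Proof.
move=> XY A mA; have := XY (setT `*` A) (measurableX measurableT mA).
have preE (Z Z' : {RV P >-> R}) : rpair Z Z' @^-1` (setT `*` A) = Z' @^-1` A.
  by apply/seteqP; split=> w //= [].
by rewrite !preE.
Qed.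

End SameDistribution.

(** * Totals of the bookings and the gap at departure *)

Section Bookings.
Context {R : realType} {d : measure_display} {Omega : measurableType d}.
Variables (P : probability Omega R) (m : nat).

Section BookingSum.
Variables (W : 'I_m -> {RV P >-> R}) (Wb : 'I_m -> nat -> {RV P >-> R}).
Hypothesis W2 : forall i, (W i : _ -> _) \in Lfun P 2%:E.
Hypothesis Wb_dist : forall i j, same_distribution P (Wb i j) (W i).

Lemma booking_sum_Lfun2 (x : state m) : booking_sum Wb x \in Lfun P 2%:E.
Proof.
apply: Lfun_sum => [|i]; first by rewrite lee1n.
apply: Lfun_sum => [|j]; first by rewrite lee1n.
exact: same_distribution_Lfun2 (Wb_dist i j) (W2 i).
Qed.

(** This identifies the quantity inside [ce_terminal] as the mean of the random total, so that the
    terminal gap is a Jensen gap of the positive part. *)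
Lemma mean_booking_sum (x : state m) :
  mean P (booking_sum Wb x) = \sum_(i < m) (x i)%:R * mean P (W i).
Proof.
have Wb1 i j : (Wb i j : _ -> _) \in Lfun P 1.
  exact/Lfun2_Lfun1/(same_distribution_Lfun2 (Wb_dist i j) (W2 i)).
rewrite mean_sum => [|i]; last exact: Lfun_sum.
apply: eq_bigr => i _; rewrite mean_sum//.
under eq_bigr => j _ do
  rewrite (same_distribution_mean (Wb_dist i j) (Wb1 i j) (Lfun2_Lfun1 (W2 i))).
by rewrite sumr_const card_ord mulr_natl.
Qed.

End BookingSum.

Lemma terminal_gap_le (W U : 'I_m -> {RV P >-> R})
    (Wb Ub : 'I_m -> nat -> {RV P >-> R}) (hw hv Cw Cv : R) (x : state m) :
  (forall i, (W i : _ -> _) \in Lfun P 2%:E) ->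
  (forall i, (U i : _ -> _) \in Lfun P 2%:E) ->
  (forall i j, same_distribution P (Wb i j) (W i)) ->
  (forall i j, same_distribution P (Ub i j) (U i)) ->
  0 <= hw -> 0 <= hv ->
  ce_terminal W U ( *%R hw) ( *%R hv) Cw Cv x -
    random_terminal Wb Ub ( *%R hw) ( *%R hv) Cw Cv x <=
  overload_bound hw Cw Wb x + overload_bound hv Cv Ub x.
Proof.
move=> W2 U2 WbW UbU hw0 hv0.
have [w1 wle] := mean_pos_part_le Cw (booking_sum_Lfun2 W2 WbW x).
have [v1 vle] := mean_pos_part_le Cv (booking_sum_Lfun2 U2 UbU x).
rewrite /ce_terminal /random_terminal -(mean_booking_sum W2 WbW).
rewrite -(mean_booking_sum U2 UbU).
set pw := fun w => pos_part (booking_sum Wb x w - Cw) in w1 wle *.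
set pv := fun w => pos_part (booking_sum Ub x w - Cv) in v1 vle *.
(* Linearity of the mean relies on the integrability of both overloads, [w1] and [v1]. *)
have -> : mean P (fun w => hw * pw w + hv * pv w) =
    hw * mean P pw + hv * mean P pv.
  rewrite -!meanZ// -meanD ?Lfun_scale//; congr mean.
  by apply/funext => w; rewrite /= (mulrC hw) (mulrC hv).
have := ler_wpM2l hw0 wle; have := ler_wpM2l hv0 vle.
rewrite /overload_bound; lra.
Qed.

End Bookings.

(** * Backward propagation of the gap *)

Section Recursion.
Context {R : realType} {m : nat}.
Variables (b : nat -> 'I_m -> R -> R) (Q : 'I_m -> R) (xmax : nat).
Implicit Types (V J : state m -> R) (x : state m).

Lemma norm1_add_booking x i : norm1 (add_booking x i) = (norm1 x).+1.
Proof.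
rewrite /norm1; under eq_bigr do rewrite ffunE.
rewrite big_split/= (_ : (\sum_(k < m) (k == i))%N = 1%N) ?addn1//.
by rewrite (bigD1 i)//= eqxx big1// => k /negbTE ->.
Qed.

(* With [D = V - J], the gap after one step is the convex combination
   [\sum_i b_i D (x + e_i) + (1 - \sum_i b_i) D x]. *)
Lemma price_step_gap_le (rbar : nat -> state m -> 'I_m -> R) t V J (M : R) x :
  (forall i, 0 <= b t i (rbar t x i)) ->
  \sum_(i < m) b t i (rbar t x i) <= 1 ->
  (forall y, (norm1 y <= xmax)%N -> V y - J y <= M) ->
  (norm1 x <= xmax)%N ->
  price_step b Q xmax rbar t V x - price_step b Q xmax rbar t J x <= M.
Proof.
move=> b0 b1 VJ xM; rewrite /price_step; case: ifPn => [xlt|_]; last exact: VJ.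
pose D y := V y - J y.
have -> : \sum_(i < m) gain b Q V t x i (rbar t x i) + V x -
    (\sum_(i < m) gain b Q J t x i (rbar t x i) + J x) =
    \sum_(i < m) b t i (rbar t x i) * (D (add_booking x i) - D x) + D x.
  rewrite opprD addrACA -sumrB; congr (_ + _); apply: eq_bigr => i _.
  (* The revenue terms [r * Q i] are the same in both recursions and cancel. *)
  by rewrite /gain /D; ring.
rewrite -lerBrDr; apply: (@le_trans _ _
    (\sum_(i < m) b t i (rbar t x i) * (M - D x))).
  apply: ler_sum => i _; apply: ler_wpM2l => //.
  (* Since [norm1 x < xmax], the state after one more booking is still in range. *)
  by rewrite lerD2r VJ// norm1_add_booking.
(* The weights sum to at most 1, and [M - D x] is non-negative by the bound at [x] itself. *)
rewrite -mulr_suml; apply: ler_piMl => //.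
by rewrite subr_ge0 VJ.
Qed.

(** An attained supremum is a maximum; attainment also makes the set non-empty and bounded, which
    rules out the junk value of [sup]. *)
Lemma opt_step_price_step (rbar : nat -> state m -> 'I_m -> R) t V x :
  ((norm1 x < xmax)%N -> forall i, 0 < rbar t x i /\
    forall r, 0 < r -> gain b Q V t x i r <= gain b Q V t x i (rbar t x i)) ->
  opt_step b Q xmax t V x = price_step b Q xmax rbar t V x.
Proof.
rewrite /opt_step /price_step; case: ifPn => // xlt /(_ isT) rmax.
congr (_ + _); apply: eq_bigr => i _; have [r0 rub] := rmax i.
apply/le_anti/andP; split.
  apply: ge_sup => [|_ [r /= + <-]]; last by rewrite in_itv/= andbT => /rub.
  exists (gain b Q V t x i (rbar t x i)), (rbar t x i) => //=.
  by rewrite in_itv/= r0.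
apply: ub_le_sup; last by exists (rbar t x i) => //=; rewrite in_itv/= r0.
exists (gain b Q V t x i (rbar t x i)) => _ [r /= + <-].
by rewrite in_itv/= andbT => /rub.
Qed.

Lemma backward_gap_le VT JT (T : nat) rbar (M : R) :
  (forall t x i, (t < T)%N -> 0 <= b t i (rbar t x i)) ->
  (forall t x, (t < T)%N -> \sum_(i < m) b t i (rbar t x i) <= 1) ->
  maximizing_price b Q xmax VT T rbar ->
  (forall x, (norm1 x <= xmax)%N -> VT x - JT x <= M) ->
  forall t x, (t <= T)%N -> (norm1 x <= xmax)%N ->
    backward (opt_step b Q xmax) VT T t x -
    backward (price_step b Q xmax rbar) JT T t x <= M.
Proof.
move=> b0 b1 rmax VJT t x tT; rewrite -(subKn tT).
(* Induction on the number [n] of remaining periods, for all states at once; keeping [n <= T] makes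
   the truncated subtraction [T - n] exact. *)
elim: (T - t)%N (leq_subr t T) x => [|n IHn] nT x xM.
  by rewrite subn0 !backward_end VJT.
have tlt : (T - n.+1 < T)%N by rewrite ltn_subrL (leq_trans _ nT).
rewrite !(backwardS _ _ tlt) (@opt_step_price_step rbar); last first.
  by move=> xlt i; apply: rmax.
rewrite subnSK//; apply: price_step_gap_le => //.
- by move=> i; apply: b0.
- exact: b1.
- by move=> y; apply: IHn; apply: ltnW.
Qed.

End Recursion.

Unset Implicit Arguments.
Set Strict Implicit.
Set Printing Implicit Defensive.

Theorem theorem2 (R : realType) (d : measure_display)
  (Omega : measurableType d) (P : probability Omega R)
  (m T xmax : nat)
  (* generic weight and volume of each type *)
  (W U : 'I_m -> {RV P >-> R})
  (W_ge0 : forall i, {ae P, forall w, 0 <= W i w})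
  (U_ge0 : forall i, {ae P, forall w, 0 <= U i w})
  (W_mean : forall i, P.-integrable setT (EFin \o W i))
  (U_mean : forall i, P.-integrable setT (EFin \o U i))
  (W_var : forall i, ('V_P[W i] < +oo)%E)
  (U_var : forall i, ('V_P[U i] < +oo)%E)
  (* weight and volume of the individual bookings of each type *)
  (Wb Ub : 'I_m -> nat -> {RV P >-> R})
  (WUb_indep : mutually_independent P
     (fun k : 'I_m * nat => rpair (Wb k.1 k.2) (Ub k.1 k.2)))
  (WUb_dist : forall i j,
     same_distribution P (rpair (Wb i j) (Ub i j)) (rpair (W i) (U i)))
  (* arrival probabilities *)
  (q : nat -> 'I_m -> R)
  (q_ge0 : forall t i, (t < T)%N -> 0 <= q t i)
  (q_sum : forall t, (t < T)%N -> \sum_(i < m) q t i <= 1)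
  (* reservation prices and their distribution functions *)
  (rho : nat -> 'I_m -> {RV P >-> R})
  (F : nat -> 'I_m -> R -> R)
  (F_cdf : forall t i r, (t < T)%N -> cdf (rho t i) r = (F t i r)%:E)
  (F_diff : forall t i r, (t < T)%N -> 0 < r -> derivable (F t i) r 1)
  (gamma : R) (gamma_gt0 : 0 < gamma)
  (Cw Cv hw hv : R) (hw_ge0 : 0 <= hw) (hv_ge0 : 0 <= hv)
  (rbar : nat -> state m -> 'I_m -> R) :
  let b := booking_prob q F in
  let Q := chargeable_weight W U gamma in
  let cost_w := fun z : R => hw * z in
  let cost_v := fun z : R => hv * z in
  let VT := ce_terminal W U cost_w cost_v Cw Cv in
  let JT := random_terminal Wb Ub cost_w cost_v Cw Cv in
  let V := backward (opt_step b Q xmax) VT T in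
  let J := backward (price_step b Q xmax rbar) JT T in
  maximizing_price b Q xmax VT T rbar ->
  forall (t : nat) (x : state m), (t <= T)%N -> (norm1 x <= xmax)%N ->
    V t x - J t x <=
    max_states xmax
      (fun y => overload_bound hw Cw Wb y + overload_bound hv Cv Ub y).
Proof.
move=> b Q cost_w cost_v VT JT V J rmax.
(* Values of a distribution function lie in [0, 1], so [0 <= b <= q]: the acceptance probabilities
   can serve as weights. *)
have pr_F t i r : (t < T)%N -> 0 <= F t i r <= 1.
  by move=> tT; rewrite -!lee_fin -(F_cdf t i r tT) cdf_ge0 cdf_le1.
have b0 t i r : (t < T)%N -> 0 <= b t i r.
  move=> tT; have /andP[_ F1] := pr_F t i r tT.
  by rewrite mulr_ge0 ?q_ge0// subr_ge0.
have b1 t i r : (t < T)%N -> b t i r <= q t i.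
  move=> tT; have /andP[F0 _] := pr_F t i r tT.
  by rewrite ler_piMr ?q_ge0// gerBl.
have WbW i j := same_distribution_fst (WUb_dist i j).
have UbU i j := same_distribution_snd (WUb_dist i j).
have W2 i : (W i : _ -> _) \in Lfun P 2%:E by exact: variance_lty_Lfun2.
have U2 i : (U i : _ -> _) \in Lfun P 2%:E by exact: variance_lty_Lfun2.
apply: (backward_gap_le _ _ rmax) => [t x i tT|t x tT|x xM].
- exact: b0.
- by apply: le_trans (q_sum t tT); apply: ler_sum => i _; exact: b1.
apply: le_trans (terminal_gap_le Cw Cv x W2 U2 WbW UbU hw_ge0 hv_ge0) _.
by apply: (max_statesP _ _).2.
Qed.
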